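(* Let $p\in(0,+\infty)$. Let $\mathbf{b}=(b_n)_{n\in\mathbb{N}}\subset\mathbb{C}$ be a $p$-mean convergent sequence with $\lim_{n\to\infty}M_{\mathbf{b},1;p}(n)=b$, and let $f:(0,1]\to\mathbb{R}$ be a monotone function such that $f\in L^1((0,1],x^{p-1}\,\mathrm{d}x)$ and the function $x\mapsto x^p$ belongs to $L^1((0,1],|\mathrm{d}f|)$. Then $$\lim_{n\to\infty}M_{\mathbf{b},f;p}(n)=b\,p\int_0^1x^{p-1}f(x)\,\mathrm{d}x.$$
   Context: $\mathbb{N}=\{1,2,3,\dots\}$. For a function $f:(0,1]\to\mathbb{R}$, a sequence $\mathbf{b}=(b_n)_{n\in\mathbb{N}}\subset\mathbb{C}$ and $p\in(0,+\infty)$, set $$M_{\mathbf{b},f;p}(n):=\frac{1}{n^p}\sum_{k=1}^n b_k f(k/n),\qquad n\in\mathbb{N}.$$ Here $M_{\mathbf{b},1;p}(n)=\frac{1}{n^p}\sum_{k=1}^n b_k$ corresponds to the constant function $f=1$. The sequence $\mathbf{b}$ is called $p$-mean convergent if the sequence $(M_{\mathbf{b},1;p}(n))_{n\in\mathbb{N}}$ converges in $\mathbb{C}$. For a monotone function $f:(0,1]\to\mathbb{R}$, $|\mathrm{d}f|$ denotes the (possibly infinite) Borel measure on $(0,1]$ induced by the Lebesgue--Stieltjes integral with respect to $f$ if $f$ is increasing, or with respect to $-f$ if $f$ is decreasing. That is, $|\mathrm{d}f|((s,t])=|f(t^+)-f(s^+)|$ for $0<s<t\le 1$, with the convention $f(1^+):=f(1)$.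 Monotone means increasing or decreasing in the weak sense. *)

(* Defs.v *)
From HB Require Import structures.
From mathcomp Require Import all_boot all_order all_algebra.
From mathcomp Require Import complex.
From mathcomp Require Import all_classical all_reals all_analysis.
From mathcomp Require Import measurable_realfun.

Set Implicit Arguments.
Unset Strict Implicit.
Unset Printing Implicit Defensive.

Import Order.TTheory GRing.Theory Num.Theory.
Import numFieldNormedType.Exports.

Local Open Scope classical_set_scope.
Local Open Scope complex_scope.
Local Open Scope ring_scope.

(* Functions (0,1] -> R are total functions R -> R of which only the values on
   `]0, 1] are used; sequences indexed by {1, 2, ...} are functions on nat whose
   value at 0 is never used.  Complex values are taken in R[i]^o, the alias of
   R[i] that carries the topology of the complex modulus. *)

Definition pmean (R : realType) (b_ : nat -> R[i]) (f : R -> R) (p : R)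
    (n : nat) : R[i]^o :=
  ((n%:R `^ p)^-1)%:C * \sum_(1 <= k < n.+1) b_ k * (f (k%:R / n%:R))%:C.

Definition monotone01 (R : realType) (f : R -> R) : Prop :=
  {in `]0, 1] &, nondecreasing_fun f} \/ {in `]0, 1] &, nonincreasing_fun f}.

(* f(x^+) for x in (0,1], with the convention f(1^+) := f(1) *)
Definition rlim (R : realType) (f : R -> R) (x : R) : R :=
  if x == 1 then f 1 else lim (f y @[y --> x^'+]).

(* For monotone f this determines mu on the Borel subsets of (0,1], where it is
   |df|: see is_abs_df_exists and is_abs_df_unique.  The values of mu outside
   (0,1] are unconstrained. *)
Definition is_abs_df (R : realType) (f : R -> R)
    (mu : {measure set (measurableTypeR R) -> \bar R}) : Prop :=
  forall s t : R, 0 < s -> s < t -> t <= 1 ->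
    mu `]s, t]%classic = `|rlim f t - rlim f s|%:E.

Section abs_df_existence.
Context (R : realType) (f : R -> R).

Lemma rlimN (x : R) : 0 < x <= 1 -> monotone01 f ->
  rlim (\- f) x = - rlim f x.
Proof.
move=> /andP[x0 x1] mf; rewrite /rlim; case: eqVneq => // xn1.
have {xn1}x1 : x < 1 by rewrite lt_neqAle xn1.
have sub : {subset `]x, 1[ <= `]0, 1]}.
  by move=> y; rewrite !in_itv/= => /andP[/(lt_trans x0)-> /ltW->].
have f01 y : y \in `]x, 1[ -> (x \in `]0, 1]) * (x <= y).
  by rewrite !in_itv/= x0 (ltW x1) => /andP[/ltW->].
suff cf : cvg (f y @[y --> x^'+]) by apply: cvg_lim => //; exact: cvgN cf.
have X1 : (BRight x < BLeft 1)%O by rewrite bnd_simp.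
case: mf => mf; apply/cvg_ex; eexists.
- apply: (@nondecreasing_at_right_cvgr _ f x (BLeft 1)) => //.
    by move=> y z /sub y0 /sub z0; exact: mf.
  exists (f x) => _ [y /= /[dup] /f01 H /sub y0 <-].
  by apply: mf; rewrite ?H.
- apply: (@nonincreasing_at_right_cvgr _ f x (BLeft 1)) => //.
    by move=> y z /sub y0 /sub z0; exact: mf.
  exists (f x) => _ [y /= /[dup] /f01 H /sub y0 <-].
  by apply: mf; rewrite ?H.
Qed.

Context (ndf : {in `]0, 1] &, nondecreasing_fun f}).

Lemma rlim_le (x y : R) : 0 < x -> x < y -> y <= 1 -> rlim f x <= f y.
Proof.
move=> x0 xy y1; have xl1 := lt_le_trans xy y1.
rewrite /rlim (lt_eqF xl1).
have X1 : (BRight x < BRight y)%O by rewrite bnd_simp.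
have sub : {subset `]x, y] <= `]0, 1]}.
  move=> z; rewrite !in_itv/= => /andP[/(lt_trans x0)-> /=].
  by move=> /le_trans; apply.
have lb : has_lbound (f @` [set` `]x, y]]).
  exists (f x) => _ [z /= zx <-]; apply: ndf (sub _ zx) _.
    by rewrite in_itv/= x0 ltW.
  by move: zx; rewrite in_itv/= => /andP[/ltW].
have -> : lim (f y @[y --> x^'+]) = inf (f @` [set` `]x, y]]).
  apply/cvg_lim => //; apply: nondecreasing_at_right_cvgr => //.
  by move=> u v /sub u0 /sub v0; exact: ndf.
by apply: ge_inf => //; exists y => //=; rewrite in_itv/= xy lexx.
Qed.

Lemma le_rlim (x : R) : 0 < x <= 1 -> f x <= rlim f x.
Proof.
move=> /andP[x0]; rewrite le_eqVlt => /predU1P[->|x1].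
  by rewrite /rlim eqxx.
rewrite /rlim (lt_eqF x1).
have sub : {subset `]x, 1[ <= `]0, 1]}.
  by move=> y; rewrite !in_itv/= => /andP[/(lt_trans x0)-> /ltW->].
have xin : x \in `]0, 1] by rewrite in_itv/= x0 ltW.
have lb : lbound (f @` [set` `]x, 1[]) (f x).
  move=> _ [z /= zx <-]; apply: ndf (sub _ zx) _ => //.
  by move: zx; rewrite in_itv/= => /andP[/ltW].
have -> : lim (f y @[y --> x^'+]) = inf (f @` [set` `]x, 1[]).
  apply/cvg_lim => //; apply: nondecreasing_at_right_cvgr => //.
    by move=> u v /sub u0 /sub v0; exact: ndf.
  by exists (f x).
apply: lb_le_inf => //; exists (f ((x + 1) / 2)), ((x+1)/2) => //=.
by rewrite in_itv/= !midf_lt.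
Qed.

Lemma rlim_adh (x e : R) : 0 < x -> x < 1 -> 0 < e -> 
  exists2 y, x < y < 1 & f y < rlim f x + e.
Proof.
move=> x0 x1 e0; rewrite /rlim (lt_eqF x1).
have sub : {subset `]x, 1[ <= `]0, 1]}.
  by move=> y; rewrite !in_itv/= => /andP[/(lt_trans x0)-> /ltW->].
have xin : x \in `]0, 1] by rewrite in_itv/= x0 ltW.
have lb : has_lbound (f @` [set` `]x, 1[]).
  exists (f x) => _ [z /= zx <-]; apply: ndf (sub _ zx) _ => //.
  by move: zx; rewrite in_itv/= => /andP[/ltW].
have -> : lim (f y @[y --> x^'+]) = inf (f @` [set` `]x, 1[]).
  apply/cvg_lim => //; apply: nondecreasing_at_right_cvgr => //.
  by move=> u v /sub u0 /sub v0; exact: ndf.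
have infS : has_inf (f @` [set` `]x, 1[]).
  split => //; exists (f ((x + 1) / 2)), ((x + 1) / 2) => //=.
  by rewrite in_itv/= !midf_lt.
have [_ [y /= + <-] fy] := inf_adherent e0 infS.
by rewrite in_itv/= => y1; exists y.
Qed.

(* Transported by ln, the regularization x |-> f(x^+), constant beyond 1, is a
   cumulative function on R even when f is unbounded near 0; |df| is the
   pushforward by expR of its Lebesgue-Stieltjes measure. *)
Let F (x : R) := rlim f (Num.min (expR x) 1).

Let minexp (x : R) : 0 < Num.min (expR x) 1 <= 1.
Proof. by rewrite lt_min expR_gt0 ltr01 ge_min lexx orbT. Qed.

Let Fnd : nondecreasing F.
Proof.
move=> x y xy; rewrite /F.
have : Num.min (expR x) 1 <= Num.min (expR y) 1 by rewrite le_min2// ler_expR.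
rewrite le_eqVlt => /predU1P[->//|H].
have /andP[x0 _] := minexp x; have /andP[_ y1] := minexp y.
by apply: le_trans (le_rlim (minexp y)); exact: rlim_le.
Qed.

Let Frc : right_continuous F.
Proof.
move=> x; apply/cvgrPdist_le => e e0.
have [x0|x0] := leP 0 x.
  near=> y; have xy : x <= y by near: y; exact: nbhs_right_ge.
  have y0 := le_trans x0 xy.
  by rewrite /F !min_r -?expR0 ?ler_expR // subrr normr0 ltW.
have ex1 : expR x < 1 by rewrite expR_lt1.
have [z /andP[xz z1] fz] := rlim_adh (expR_gt0 x) ex1 e0.
near=> y; have xy : x <= y by near: y; exact: nbhs_right_ge.
have yz : y < ln z.
  near: y; apply: nbhs_right_lt.
  by rewrite -ltr_expR lnK// posrE (lt_trans _ xz)// expR_gt0.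
have eyz : expR y < z.
  by rewrite -[z]lnK ?ltr_expR// posrE (lt_trans _ xz)// expR_gt0.
rewrite distrC ger0_norm ?subr_ge0 ?Fnd// lerBlDl.
have eF : F y <= f z.
  rewrite /F min_l; last by rewrite ltW// (lt_trans eyz).
  by apply: rlim_le => //; [exact: expR_gt0|exact: ltW].
apply: (le_trans eF); rewrite /F min_l ?(ltW ex1)//; exact: ltW.
Unshelve. all: by end_near. Qed.

HB.instance Definition _ := isCumulative.Build R _ R F Fnd Frc.

Let e : measurableTypeR R -> measurableTypeR R := expR.
Let me : measurable_fun setT e. 
Proof. exact: measurable_expR. Qed.

Lemma is_abs_df_exists_nd :
  exists mu : {measure set (measurableTypeR R) -> \bar R}, is_abs_df f mu.
Proof.
have [mu muE] : exists mu : {measure set (measurableTypeR R) -> \bar R},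
  forall A, mu A = lebesgue_stieltjes_measure F (e @^-1` A).
  unshelve (by exists (pushforward (lebesgue_stieltjes_measure F) e)).
  exact: me.
exists mu => s t s0 st t1; rewrite muE.
have t0 := lt_trans s0 st.
have -> : e @^-1` `]s, t]%classic = `]ln s, ln t]%classic.
  apply/seteqP; split => x/=; rewrite !in_itv/= /e;
    by rewrite -(ltr_expR (ln s)) -(ler_expR x (ln t)) !lnK.
rewrite /lebesgue_stieltjes_measure /= /measure_extension /=.
rewrite measurable_mu_extE/=; last exact: is_ocitv.
rewrite wlength_itv_bnd ?ler_ln ?(ltW st)//.
have FE x : 0 < x -> x <= 1 -> F (ln x) = rlim f x.
  by move=> x0 x1; rewrite /F lnK// min_l.
have s1 : s <= 1 by rewrite ltW// (lt_le_trans st).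
rewrite -(FE s)// -(FE t)// ger0_norm ?EFinB// subr_ge0 Fnd// ler_ln//.
exact: ltW.
Qed.
End abs_df_existence.

Lemma is_abs_df_exists (R : realType) (f : R -> R) : monotone01 f ->
  exists mu : {measure set (measurableTypeR R) -> \bar R}, is_abs_df f mu.
Proof.
move=> mf; have [|f_ni] := mf; first exact: is_abs_df_exists_nd.
have [|mu muE] := @is_abs_df_exists_nd R (\- f).
  by move=> x y x0 y0 xy; rewrite /= lerN2; exact: f_ni.
exists mu => s t s0 st t1; rewrite muE// !rlimN ?s0 ?(lt_trans s0 st) ?t1//.
  by rewrite -opprD normrN.
by rewrite ltW// (lt_le_trans st).
Qed.

Lemma is_abs_df_unique (R : realType) (f : R -> R)
    (mu nu : {measure set (measurableTypeR R) -> \bar R}) :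
  is_abs_df f mu -> is_abs_df f nu ->
  forall A : set (measurableTypeR R),
    measurable A -> A `<=` `]0, 1]%classic -> mu A = nu A.
Proof.
move=> muE nuE A mA A01.
pose I (n : nat) : set (measurableTypeR R) := `]n.+1%:R^-1, 1]%classic.
have -> : A = \bigcup_n (A `&` I n).
  apply/seteqP; split => [x Ax|x [n _ []]//].
  have := A01 _ Ax; rewrite /= in_itv/= => /andP[x0 x1].
  have [n xn] : exists n : nat, n.+1%:R^-1 < x.
    exists (Num.truncn x^-1); rewrite invf_plt ?posrE//.
    exact: truncnS_gt.
  by exists n => //; split => //; rewrite /I /= in_itv/= xn.
have mI n : measurable (I n) by exact: measurable_itv.
have ndI : nondecreasing_seq (fun n => A `&` I n).
  move=> m n mn; apply/subsetPset; apply: setIS => x.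
  rewrite /I /= !in_itv/= => /andP[mx ->]; rewrite andbT (le_lt_trans _ mx)//.
  by rewrite lef_pV2 ?posrE// ler_nat.
have mAI n : measurable (A `&` I n) by exact: measurableI.
suff E n : mu (A `&` I n) = nu (A `&` I n).
  have cm := nondecreasing_cvg_mu mAI (bigcupT_measurable _ mAI) ndI.
  have cn := nondecreasing_cvg_mu mAI (bigcupT_measurable _ mAI) ndI.
  apply: (cvg_unique _ (cm _ mu)) => //.
  rewrite (_ : mu \o _ = nu \o (fun n => A `&` I n)); last exact/funext.
  exact: cn.
have ocI (a b : R) : mu (`]a, b]%classic `&` I n) = nu (`]a, b]%classic `&` I n).
  have -> : `]a, b]%classic `&` I n =
      `]Num.max a n.+1%:R^-1, Num.min b 1]%classic.
    apply/seteqP; split => x; rewrite /I /= !in_itv/= gt_max le_min.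
      by case=> /andP[-> ->] /andP[-> ->].
    by case/andP => /andP[-> ->] /andP[-> ->].
  have [h|h] := ltP (Num.max a n.+1%:R^-1) (Num.min b 1); last first.
    by rewrite set_itv_ge ?measure0// bnd_simp -leNgt.
  have h0 : 0 < Num.max a n.+1%:R^-1 by rewrite lt_max invr_gt0 ltr0n orbT.
  have h1 : Num.min b 1 <= 1 by rewrite ge_min lexx orbT.
  by rewrite muE// nuE.
have := @measure_unique _ R (measurableTypeR R) (@ocitv R)
  (fun k => `](- k%:R), k%:R]%classic) erefl (@ocitvI R) _ _
  (mrestr mu (mI n)) (mrestr nu (mI n)) _ _ A mA.
apply.
- by move=> k; exact: is_ocitv.
- apply/seteqP; split => // x _.
  exists (Num.bound `|x|); rewrite //= in_itv/=.
  have : `|x| < (Num.bound `|x|)%:R by exact: archi_boundP.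
  by rewrite ltr_norml => /andP[-> /ltW->].
- by move=> _ [[a b] _ <-]; exact: ocI.
- move=> k; rewrite /= /mrestr.
  apply: (@le_lt_trans _ _ (mu (I n))).
    apply: le_measure; last exact: subIsetr; rewrite inE//.
    by apply: measurableI => //; exact: is_ocitv.
  have [n1|n1] := ltP (n.+1%:R^-1 : R) 1.
    by rewrite muE ?invr_gt0// ltry.
  by rewrite /I set_itv_ge ?measure0// bnd_simp -leNgt.
Qed.

(* Main.v *)
Require Import Defs.
From HB Require Import structures.
From mathcomp Require Import all_boot all_order all_algebra.
From mathcomp Require Import complex.
From mathcomp Require Import all_classical all_reals all_analysis.
From mathcomp Require Import measurable_realfun.
From mathcomp Require Import ring.

Set Implicit Arguments.
Unset Strict Implicit.
Unset Printing Implicit Defensive.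

Import Order.TTheory GRing.Theory Num.Theory.
Import numFieldNormedType.Exports.

Local Open Scope classical_set_scope.
Local Open Scope complex_scope.
Local Open Scope ring_scope.

(** Subtracting the constant [f 1], for which the claim is the hypothesis, and
    changing the sign if [f] is nondecreasing reduces the theorem to a
    nonincreasing [g >= 0] with [g 1 = 0].  Write [M n] for the mean
    [pmean b_ (cst 1) p n].  Summation by parts ([pmean_by_parts]) gives
      [pmean b_ g p n = \sum_(1 <= k < n) w n k * M k],
      [w n k = (k/n)^p (g(k/n) - g((k+1)/n)) >= 0],
    and [M k] converges to [b].  By Toeplitz's theorem ([toeplitz_cvg]) it is
    enough that each column [w n k] tends to [0] as [n] grows and that the row
    sums converge to the integral of [p x^(p-1) g(x)].

    Summing by parts backwards ([sum_powR_by_parts]), the row sum is the right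
    Riemann sum of [g] with respect to [x^p], that is, the integral of
    [p x^(p-1) h_n(x)] for a step function [0 <= h_n <= g].  A monotone function
    is continuous outside a countable set, so [h_n] converges to [g] almost
    everywhere, and dominated convergence yields the limit
    ([cvg_right_riemann_sum]).  The columns are bounded by [(k/n)^p g(k/n)],
    which tends to [0] by dominated convergence again ([cvg_powR_sample0]). *)

(** * Summation by parts and Toeplitz's theorem *)

Lemma sum_mul_by_parts (K : comPzRingType) (b u : nat -> K) (n : nat) :
  \sum_(1 <= k < n.+1) b k * u k =
    (\sum_(1 <= j < n.+1) b j) * u n +
    \sum_(1 <= k < n) (\sum_(1 <= j < k.+1) b j) * (u k - u k.+1).
Proof.
elim: n => [|n IHn]; first by rewrite !big_geq// mul0r addr0.
rewrite big_nat_recr//= IHn (big_nat_recr n.+1)//=.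
case: n IHn => [|n] _; first by rewrite !big_geq//; ring.
by rewrite [X in _ = _ + X]big_nat_recr//=; ring.
Qed.

(** Toeplitz's theorem for triangular arrays of nonnegative weights with
    convergent row sums: each column dies out, so only the tail of [c] matters,
    and there [c] is uniformly close to [l]. *)
Lemma toeplitz_cvg (K : numFieldType) (w : nat -> nat -> K) (c : nat -> K)
    (s l : K) :
  (forall n k, (0 < k < n)%N -> 0 <= w n k) ->
  (forall k, (0 < k)%N -> w n k @[n --> \oo] --> (0 : K^o)) ->
  \sum_(1 <= k < n) w n k @[n --> \oo] --> (s : K^o) ->
  c n @[n --> \oo] --> (l : K^o) ->
  \sum_(1 <= k < n) w n k * c k @[n --> \oo] --> (s * l : K^o).
Proof.
move=> w_ge0 w_cvg0 w_cvg c_cvg.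
(* The row sums carry the constant l to s * l, so let c tend to 0. *)
suff cvg0 : \sum_(1 <= k < n) w n k * (c k - l) @[n --> \oo] --> (0 : K^o).
  have -> : (fun n => \sum_(1 <= k < n) w n k * c k) =
      (fun n => \sum_(1 <= k < n) w n k * (c k - l) +
                (\sum_(1 <= k < n) w n k) * l).
    apply/funext => n; rewrite mulr_suml -big_split/=.
    by apply: eq_bigr => k _; rewrite mulrBr subrK.
  rewrite -[s * l]add0r; apply: (@cvgD _ K^o) => //.
  by apply: (@cvgMr_tmp K _ _ _ _ _ l).
apply/(@cvgrPdist_le _ K^o) => e e0.
have s1_gt0 : 0 < `|s| + 1 by rewrite ltr_wpDl.
have e'_gt0 : 0 < e / 2 / (`|s| + 1) by rewrite !divr_gt0.
have [N _ NP] : \forall n \near \oo, `|l - c n| <= e / 2 / (`|s| + 1).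
  by move/(@cvgrPdist_le _ K^o) : c_cvg => /(_ _ e'_gt0).
have head0 : \sum_(1 <= k < N.+1) w n k * (c k - l) @[n --> \oo] --> (0 : K^o).
  rewrite [X in _ --> X](_ : _ = \sum_(1 <= k < N.+1) (0 : K^o)); last first.
    by rewrite big1.
  rewrite big_nat; under eq_fun do rewrite big_nat.
  apply: cvg_big => [|k /andP[k0 _]]; first exact: add_continuous.
  rewrite -[X in _ --> X](mul0r (c k - l)).
  by apply: (@cvgMr_tmp K _ _ _ _ _ _); exact: w_cvg0.
have e2 : 0 < e / 2 by rewrite divr_gt0.
near=> n; rewrite sub0r normrN.
have Nn : (N.+1 <= n)%N by near: n; exact: nbhs_infty_ge.
rewrite (@big_cat_nat _ _ _ N.+1)//= [e]splitr.
apply: (le_trans (ler_normD _ _)); apply: lerD.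
  rewrite -normrN -sub0r; near: n.
  by move/(@cvgrPdist_le _ K^o) : head0 => /(_ _ e2).
apply: (le_trans (ler_norm_sum _ _ _)).
apply: (@le_trans _ _ (\sum_(N.+1 <= k < n) w n k * (e / 2 / (`|s| + 1)))).
  rewrite big_nat [leRHS]big_nat; apply: ler_sum => k /andP[Nk kn].
  have wk : 0 <= w n k by rewrite w_ge0// kn (leq_ltn_trans _ Nk).
  by rewrite normrM ger0_norm// ler_wpM2l// distrC NP//= ltnW.
rewrite -mulr_suml mulrA ler_pdivrMr// mulrC ler_pM2l//.
apply: (@le_trans _ _ (\sum_(1 <= k < n) w n k)).
  rewrite [leRHS](@big_cat_nat _ _ _ N.+1)//= lerDr big_nat sumr_ge0// => k.
  by move=> /andP[k0 kN]; rewrite w_ge0// k0 (leq_trans kN).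
have sum_ge0 : 0 <= \sum_(1 <= k < n) w n k.
  by rewrite big_nat sumr_ge0// => k k0; rewrite w_ge0.
rewrite -(ger0_norm sum_ge0) -lerBlDl; apply: (le_trans (lerB_dist _ _)).
rewrite distrC; near: n.
by move/(@cvgrPdist_le _ K^o) : w_cvg => /(_ _ ltr01).
Unshelve. all: by end_near. Qed.

Lemma cvg_lincomb (K : numFieldType) (u v : nat -> K) (a b c d : K) :
  u n @[n --> \oo] --> (a : K^o) -> v n @[n --> \oo] --> (b : K^o) ->
  c * u n + d * v n @[n --> \oo] --> (c * a + d * b : K^o).
Proof.
move=> ua vb; apply: (@cvgD _ K^o).
  exact: (@cvgMl_tmp K _ _ _ _ c).
exact: (@cvgMl_tmp K _ _ _ _ d).
Qed.

(** * Real sequences inside the complex numbers *)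

Lemma cvg_real_complex (R : realType) (u : nat -> R) (l : R) :
  u n @[n --> \oo] --> l -> (u n)%:C @[n --> \oo] --> (l%:C : R[i]^o).
Proof.
move=> ul; apply/(@cvgrPdist_le _ R[i]^o) => e e0.
have [r re] : exists r, e = r%:C by apply/complex_realP; rewrite gtr0_real.
rewrite re ltcR in e0; near=> n.
have -> : l%:C - (u n)%:C = (l - u n)%:C by rewrite rmorphB.
rewrite normc_def/= expr0n/= addr0 sqrtr_sqr re lecR; near: n.
by move/cvgrPdist_le : ul => /(_ _ e0).
Unshelve. all: by end_near. Qed.

(** * Integration against the density p x^(p-1) *)

Lemma within_continuous_powR (R : realType) (p a b : R) : 0 < a ->
  {within `[a, b], continuous (fun x => x `^ p)}.
Proof.
move=> a0; apply: derivable_within_continuous => x.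
rewrite in_itv/= => /andP[ax _]; apply: derivable_powR.
by rewrite in_itv/= andbT (lt_le_trans a0).
Qed.

Lemma integral_powR_pos (R : realType) (p a b : R) : 0 < a -> a < b ->
  (\int[lebesgue_measure]_(x in `]a, b]) (p * x `^ (p - 1))%:E =
    (b `^ p - a `^ p)%:E)%E.
Proof.
move=> a0 ab.
have pos x : a <= x -> x \in `]0, +oo[.
  by move=> ax; rewrite in_itv/= andbT (lt_le_trans a0).
have cpow (x : R) : a <= x -> {for x, continuous (fun y : R => y `^ p)}.
  move=> ax; apply: differentiable_continuous; apply/derivable1_diffP.
  by apply: derivable_powR; exact: pos.
rewrite integral_itv_obnd_cbnd; last first.
  apply/measurable_EFinP/measurable_funM => //.
  by apply: measurable_funTS; exact: measurable_powR.
rewrite (@continuous_FTC2 _ _ (fun x => x `^ p)) ?EFinB//.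
- by move=> x; apply: cvgM; [exact: cvg_cst|exact: within_continuous_powR].
- split.
  + move=> x; rewrite in_itv/= => /andP[ax _].
    by apply: derivable_powR; rewrite pos// ltW.
  + by apply: cvg_at_right_filter; exact: cpow.
  + by apply: cvg_at_left_filter; apply: cpow; exact: ltW.
- move=> x; rewrite in_itv/= => /andP[ax _].
  by rewrite powR_derive1// pos// ltW.
Qed.

(** The left endpoint may be [0], where the integrand is unbounded if [p < 1]:
    exhaust [`]0, b]] by the intervals [`]b / n.+2, b]]. *)
Lemma integral_powR (R : realType) (p a b : R) : 0 < p -> 0 <= a -> a <= b ->
  (\int[lebesgue_measure]_(x in `]a, b]) (p * x `^ (p - 1))%:E =
    (b `^ p - a `^ p)%:E)%E.
Proof.
move=> p0; rewrite le_eqVlt => /predU1P[<-|a0]; last first.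
  rewrite le_eqVlt => /predU1P[<-|]; last exact: integral_powR_pos.
  by rewrite set_itv_ge ?bnd_simp// integral_set0 subrr.
rewrite powR0 ?gt_eqF// subr0.
rewrite le_eqVlt => /predU1P[<-|b0].
  by rewrite set_itv_ge ?bnd_simp// integral_set0 powR0 ?gt_eqF.
pose F n : set (measurableTypeR R) := `](b / n.+2%:R), b]%classic.
have FE : `]0, b]%classic = \bigcup_n F n.
  apply/seteqP; split => [x|x [n _]]; rewrite /F /= !in_itv/=; last first.
    by move=> /andP[nx ->]; rewrite andbT (le_lt_trans _ nx)// divr_ge0// ltW.
  move=> /andP[x0 xb]; exists (Num.truncn (b / x)) => //=.
  rewrite in_itv/= xb andbT ltr_pdivrMr// mulrC -ltr_pdivrMr//.
  by rewrite (lt_trans (truncnS_gt _))// ltr_nat.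
have mF n : measurable (F n) by exact: measurable_itv.
have mf (D : set (measurableTypeR R)) : measurable D ->
    measurable_fun D (fun x => (p * x `^ (p - 1))%:E).
  move=> mD; apply/measurable_EFinP/measurable_funM => //.
  by apply: measurable_funTS; exact: measurable_powR.
have ndF : nondecreasing_seq F.
  move=> m n mn; apply/subsetPset => x; rewrite /F /= !in_itv/=.
  move=> /andP[mx ->]; rewrite andbT (le_lt_trans _ mx)// ler_pM2l//.
  by rewrite lef_pV2 ?posrE// ler_nat.
have := @ge0_nondecreasing_set_cvg_integral _ _ R F
  (fun x => (p * x `^ (p - 1))%:E) lebesgue_measure ndF mF (fun i => mf _ (mF i)).
rewrite -FE => cvgF; apply/esym/(cvg_unique _ _ (cvgF _)) => //; last first.
  by move=> i x _; rewrite lee_fin mulr_ge0// ?powR_ge0// ltW.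
have bn0 n : 0 < b / n.+2%:R by rewrite divr_gt0.
have -> : (fun n => \int[lebesgue_measure]_(x in F n) (p * x `^ (p - 1))%:E)%E =
    (fun n => (b `^ p - (b / n.+2%:R) `^ p)%:E).
  apply/funext => n; rewrite integral_powR_pos//.
  by rewrite ltr_pdivrMr// ltr_pMr// ltr1n.
apply: cvg_EFin; first by exact: nearW.
rewrite -[X in _ --> X]subr0; apply: cvgB; first exact: cvg_cst.
have /cvg_at_rightP powR0P := powR_cvg0 p0.
apply: (powR0P (fun n => b / n.+2%:R)); split => //.
rewrite -[X in _ --> X](mulr0 b); apply: cvgMl_tmp.
by move: (@cvg_harmonic R); rewrite -cvg_shiftS.
Qed.

(** * Continuity points of monotone functions *)

(** The one-sided limits of a nondecreasing function enclose its value, so a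
    point where they agree is a point of continuity. *)
Lemma nondecreasing_not_discontinuity (R : realType) (F : R -> R) (a b x : R) :
  {in `[a, b] &, nondecreasing_fun F} -> x \in `]a, b[ ->
  ~ discontinuity F x -> {for x, continuous F}.
Proof.
move=> ndF; rewrite in_itv/= => /andP[ax xb] ndisc.
have inE y : a <= y -> y <= b -> y \in `[a, b] by rewrite in_itv/= => -> ->.
have [r Fr rF] : exists2 r, F y @[y --> x^'+] --> r & F x <= r.
  have cvgF : cvg (F y @[y --> x^'+]).
    apply: nondecreasing_at_right_is_cvgr; near=> c.
      have cb : c <= b by near: c; exact: nbhs_right_le.
      move=> y z; rewrite !in_itv/= => /andP[xy yc] /andP[xz zc].
      have [ya za] := (lt_trans ax xy, lt_trans ax xz).
      by apply: ndF; apply: inE; rewrite ?(le_trans _ cb)// ltW.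
    have cb : c <= b by near: c; exact: nbhs_right_le.
    exists (F x) => _ [y/= + <-]; rewrite in_itv/= => /andP[xy yc].
    apply: ndF (ltW xy); apply: inE; rewrite ltW//; first exact: lt_trans xy.
    exact: lt_le_trans cb.
  exists (lim (F y @[y --> x^'+])) => //.
  apply: limr_ge => //; near=> y.
  have xy : x <= y by near: y; exact: nbhs_right_ge.
  apply: ndF xy; apply: inE; rewrite ?(ltW ax) ?(ltW xb)//.
    by rewrite (le_trans (ltW ax)).
  by near: y; exact: nbhs_right_le.
have [l Fl lF] : exists2 l, F y @[y --> x^'-] --> l & l <= F x.
  have cvgF : cvg (F y @[y --> x^'-]).
    apply: nondecreasing_at_left_is_cvgr; near=> c.
      have ac : a <= c by near: c; exact: nbhs_left_ge.
      move=> y z; rewrite !in_itv/= => /andP[cy yx] /andP[cz zx].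
      have [yb zb] := (lt_trans yx xb, lt_trans zx xb).
      by apply: ndF; apply: inE; rewrite ?(le_trans ac)// ltW.
    have ac : a <= c by near: c; exact: nbhs_left_ge.
    exists (F x) => _ [y/= + <-]; rewrite in_itv/= => /andP[cy yx].
    apply: ndF (ltW yx); apply: inE; rewrite ltW//; last exact: lt_trans yx _.
    exact: le_lt_trans cy.
  exists (lim (F y @[y --> x^'-])) => //.
  apply: limr_le => //; near=> y.
  have xy : y <= x by near: y; exact: nbhs_left_le.
  apply: ndF xy; apply: inE; rewrite ?(ltW ax) ?(ltW xb)//.
    by near: y; exact: nbhs_left_ge.
  by rewrite (le_trans _ (ltW xb)).
have lr : l = r.
  apply/eqP; apply: contra_notT ndisc => lr; split.
  - by apply/cvg_ex; exists l.
  - by apply/cvg_ex; exists r.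
  - by rewrite (cvg_lim _ Fl)// (cvg_lim _ Fr).
have Fx : F x = r by apply/le_anti; rewrite rF -lr lF.
by apply/left_right_continuousP; rewrite -[in X in _ --> X /\ _]/(F x) Fx -{1}lr.
Unshelve. all: by end_near. Qed.

(** [f] may be unbounded near [0], so the countability of the discontinuities
    is applied on each [`[1 / n.+1, 1]]. *)
Lemma ae_continuous_monotone01 (R : realType) (f : R -> R) : monotone01 f ->
  {ae @lebesgue_measure R, forall x, x \in `]0, 1[ -> {for x, continuous f}}.
Proof.
wlog ndf : f / {in `]0, 1] &, nondecreasing_fun f}.
  move=> wlg; case=> [ndf|nif]; first by apply: wlg => //; left.
  have ndNf : {in `]0, 1] &, nondecreasing_fun (\- f)}.
    by move=> x y x0 y0 xy; rewrite lerN2; apply: nif.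
  have [N [mN N0 sN]] := wlg _ ndNf (or_introl ndNf); exists N; split => //.
  apply: subset_trans sN; apply: subsetC => x H /H cf.
  have -> : f = \- (\- f) by apply/funext => y /=; rewrite opprK.
  exact: continuousN.
move=> _.
pose A n := [set x | (x \in `]n.+1%:R^-1, 1[) /\ discontinuity f x].
have A0 : countable (\bigcup_n A n).
  apply: bigcup_countable => // n _; apply: discontinuity_countable => x y.
  have n0 : 0 < n.+1%:R^-1 :> R by rewrite invr_gt0.
  rewrite !in_itv/= => /andP[nx x1] /andP[ny y1].
  by apply: ndf; rewrite in_itv/= ?x1 ?y1 andbT (lt_le_trans n0).
exists (\bigcup_n A n); split.
- by apply: countable_measurable.
- exact: countable_lebesgue_measure0.
- move=> x /= /not_implyP[]; rewrite in_itv/= => /andP[x0 x1] ncf.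
  have nx : (Num.truncn x^-1).+1%:R^-1 < x.
    by rewrite invf_plt ?posrE// truncnS_gt.
  exists (Num.truncn x^-1) => //; split; first by rewrite in_itv/= nx.
  apply: contrapT => nd; apply: ncf.
  apply: (@nondecreasing_not_discontinuity _ f (Num.truncn x^-1).+1%:R^-1 1) nd.
    move=> y z; rewrite !in_itv/= => /andP[xy y1] /andP[xz z1].
    have n0 : 0 < (Num.truncn x^-1).+1%:R^-1 :> R by rewrite invr_gt0.
    by apply: ndf; rewrite in_itv/= ?y1 ?z1 andbT (lt_le_trans n0).
  by rewrite in_itv/= nx.
Qed.

(** * Right Riemann sums *)

Lemma integrable_powR01 (R : realType) (p : R) : 0 < p ->
  (@lebesgue_measure R).-integrable `]0, 1] (fun x => (p * x `^ (p - 1))%:E).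
Proof.
move=> p0; apply/integrableP; split.
  apply/measurable_EFinP/measurable_funM => //.
  by apply: measurable_funTS; exact: measurable_powR.
under eq_integral => x _.
  rewrite gee0_abs; last by rewrite lee_fin mulr_ge0// ?powR_ge0// ltW.
  over.
by rewrite integral_powR// ltry.
Qed.

Lemma integrable_powR_itv (R : realType) (p a b : R) : 0 < p ->
  (@lebesgue_measure R).-integrable `]0, 1]
    (fun x => (p * x `^ (p - 1) * \1_(`]a, b]) x)%:E).
Proof.
move=> p0; apply: le_integrable (integrable_powR01 p0) => //.
  apply/measurable_EFinP/measurable_funM => //.
  apply: measurable_funM => //.
  by apply: measurable_funTS; exact: measurable_powR.
move=> x _; rewrite lee_fin normrM ler_piMr// indicE ger0_norm//.
by case: (x \in _).
Qed.

Lemma integral_powR_itv (R : realType) (p a b : R) :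
  0 < p -> 0 <= a -> a <= b -> b <= 1 ->
  (\int[lebesgue_measure]_(x in `]0%R, 1%R])
    (p * x `^ (p - 1) * \1_(`]a, b]) x)%:E = (b `^ p - a `^ p)%:E)%E.
Proof.
move=> p0 a0 ab b1; rewrite -[RHS](integral_powR p0 a0 ab).
have -> : `]a, b]%classic = `]0, 1]%classic `&` `]a, b]%classic.
  apply/esym/setIidPr => x; rewrite /= !in_itv/= => /andP[ax xb].
  by rewrite (le_lt_trans a0 ax) (le_trans xb b1).
rewrite [in RHS]integral_mkcondr; apply: eq_integral => x x01.
rewrite patchE indicE in_setI x01 /=.
by case: ifP; rewrite ?mulr1 ?mulr0.
Qed.

(** The sampling at right endpoints makes this a minorant of a nonincreasing
    [g], so that dominated convergence applies even if [g] is unbounded near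
    [0]. *)
Definition right_step (R : realType) (g : R -> R) (n : nat) (x : R) : R :=
  \sum_(1 <= k < n.+1)
    g (k%:R / n%:R) * \1_(`](k.-1%:R / n%:R), (k%:R / n%:R)]) x.

(** The point [y] is the right end of the cell of [x]; its index is the least
    [k] such that [x <= k / n]. *)
Lemma right_stepE (R : realType) (g : R -> R) (n : nat) (x : R) :
  (0 < n)%N -> 0 < x -> x <= 1 ->
  exists y, [/\ x <= y, y <= 1, y <= x + n%:R^-1 & right_step g n x = g y].
Proof.
move=> n0 x0 x1; have n0' : 0 < n%:R :> R by rewrite ltr0n.
have [k kP kmin] : exists2 k, x <= k%:R / n%:R & forall j, x <= j%:R / n%:R -> (k <= j)%N.
  have ex : exists k, x <= k%:R / n%:R by exists n; rewrite divff ?gt_eqF.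
  by case: (ex_minnP ex) => k kP kmin; exists k.
have kn : (k <= n)%N by apply: kmin; rewrite divff ?gt_eqF.
have k0 : (0 < k)%N.
  by case: k kP {kmin kn} => //; rewrite mul0r leNgt x0.
have k1 : k.-1%:R / n%:R < x.
  by rewrite ltNge; apply/negP => /kmin; rewrite -ltnS prednK// ltnn.
exists (k%:R / n%:R); split => //.
- by rewrite ler_pdivrMr// mul1r ler_nat.
- rewrite -[in leLHS](prednK k0) -natr1 mulrDl mul1r lerD2r; exact: ltW.
- rewrite /right_step (bigD1_seq k)/= ?iota_uniq// ?mem_index_iota ?k0 ?ltnS//.
  rewrite indicE mem_set ?mulr1/=; last by rewrite in_itv/= k1.
  rewrite big_seq_cond big1 ?addr0// => j; rewrite mem_index_iota.
  rewrite neq_ltn => /andP[/andP[j0 _] jk].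
  rewrite indicE memNset ?mulr0//= in_itv/= => /andP[jx xj].
  move: jk; rewrite ltnNge (kmin _ xj)/= => kj.
  have : k%:R / n%:R <= j.-1%:R / n%:R :> R.
    by rewrite ler_pM2r ?invr_gt0// ler_nat -ltnS prednK.
  by move=> /(le_trans kP); rewrite leNgt jx.
Qed.

Lemma measurable_right_step (R : realType) (g : R -> R) (n : nat) :
  measurable_fun setT (right_step g n : measurableTypeR R -> R).
Proof.
rewrite /right_step; apply: measurable_sum => k.
apply: measurable_funM => //; apply: measurable_indic; exact: measurable_itv.
Qed.

Lemma integral_right_step (R : realType) (p : R) (g : R -> R) (n : nat) :
  0 < p ->
  (\int[lebesgue_measure]_(x in `]0%R, 1%R])
      (p * x `^ (p - 1) * right_step g n x)%:E =
   (\sum_(1 <= k < n.+1) ((k%:R / n%:R) `^ p - (k.-1%:R / n%:R) `^ p) *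
      g (k%:R / n%:R))%:E)%E.
Proof.
move=> p0; rewrite -sumEFin.
pose F (k : nat) (x : R) : \bar R := ((g (k%:R / n%:R))%:E *
  (p * x `^ (p - 1) * \1_(`](k.-1%:R / n%:R), (k%:R / n%:R)]) x)%:E)%E.
have itvP (k : nat) : (1 <= k < n.+1)%N ->
    [/\ 0 <= k.-1%:R / n%:R :> R, k.-1%:R / n%:R <= k%:R / n%:R :> R &
        k%:R / n%:R <= 1 :> R].
  move=> /andP[k0 kn]; have n0 : 0 < n%:R :> R by rewrite ltr0n (leq_trans k0).
  by rewrite divr_ge0// ler_pM2r ?invr_gt0// ler_nat leq_pred ler_pdivrMr// mul1r
    ler_nat.
transitivity (\int[lebesgue_measure]_(x in `]0%R, 1%R])
    (\sum_(1 <= k < n.+1) F k x))%E.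
  apply: eq_integral => x _; rewrite /right_step mulr_sumr -sumEFin.
  by apply: eq_bigr => k _; rewrite /F -EFinM; congr EFin; rewrite mulrCA.
rewrite integral_sum//; last first.
  by move=> k; apply: integrableZl => //; exact: integrable_powR_itv.
rewrite big_nat [RHS]big_nat; apply: eq_bigr => k /itvP[k0 kk k1].
rewrite integralZl//; last exact: integrable_powR_itv.
by rewrite integral_powR_itv// -EFinM mulrC.
Qed.

(** Dominated convergence for the density [p x^(p-1)] on [`]0, 1]], with the
    approximating integrals supplied in closed form. *)
Lemma cvg_powR_integral_dominated (R : realType) (p : R) (g h : R -> R)
    (h_ : nat -> R -> R) (I_ : nat -> R) :
  0 < p ->
  (@lebesgue_measure R).-integrable `]0, 1]
    (fun x => (p * x `^ (p - 1) * g x)%:E) ->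
  measurable_fun (`]0, 1]%classic : set (measurableTypeR R))
    (fun x : measurableTypeR R => p * x `^ (p - 1) * h x) ->
  (forall n, measurable_fun setT (h_ n : measurableTypeR R -> R)) ->
  (forall n x, x \in `]0, 1] -> `|h_ n x| <= g x) ->
  {ae @lebesgue_measure R, forall x, x \in `]0, 1] -> h_ n x @[n --> \oo] --> h x} ->
  (forall n, (\int[lebesgue_measure]_(x in `]0%R, 1%R])
    (p * x `^ (p - 1) * h_ n x)%:E = (I_ n)%:E)%E) ->
  I_ n @[n --> \oo] -->
    \int[lebesgue_measure]_(x in `]0, 1]) (p * x `^ (p - 1) * h x).
Proof.
move=> p0 ig mh mh_ h_dom h_cvg IE.
pose F (n : nat) (x : measurableTypeR R) : \bar R :=
  (p * x `^ (p - 1) * h_ n x)%:E.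
have mF n : measurable_fun (`]0, 1]%classic : set (measurableTypeR R)) (F n).
  apply/measurable_EFinP/measurable_funM.
    by apply: measurable_funM => //; apply: measurable_funTS; exact: measurable_powR.
  by apply: measurable_funTS; exact: mh_.
have F_dom : {ae lebesgue_measure, forall (x : measurableTypeR R) n,
    `]0, 1]%classic x -> (`|F n x| <= (p * x `^ (p - 1) * g x)%:E)%E}.
  apply: aeW => x n x01; have w0 : 0 <= p * x `^ (p - 1).
    by rewrite mulr_ge0 ?powR_ge0// ltW.
  by rewrite lee_fin normrM (ger0_norm w0) ler_wpM2l// h_dom.
have F_cvg : {ae lebesgue_measure, forall x : measurableTypeR R,
    `]0, 1]%classic x -> F ^~ x @ \oo --> (p * x `^ (p - 1) * h x)%:E}.
  have [N [mN N0 sN]] := h_cvg; exists N; split => //.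
  apply: subset_trans sN; apply: subsetC => x /= hx x01.
  by apply: cvg_EFin; [exact: nearW|apply: cvgMl_tmp; exact: hx].
have mh' : measurable_fun (`]0, 1]%classic : set (measurableTypeR R))
    (fun x : measurableTypeR R => (p * x `^ (p - 1) * h x)%:E).
  exact/measurable_EFinP.
have /= [/integral_fune_fin_num fin_int _] := @dominated_convergence _ _ _
  lebesgue_measure (`]0, 1]%classic : set (measurableTypeR R))
  (measurable_itv _) F _ _ mF mh' F_cvg ig F_dom.
under eq_fun do rewrite IE.
rewrite -(fineK (fin_int _))// => /fine_cvg.
exact.
Qed.

(** The sum is the integral of [right_step g n], which is dominated by [g] and
    converges to [g] wherever [g] is continuous, that is, almost everywhere. *)
Lemma cvg_right_riemann_sum (R : realType) (p : R) (g : R -> R) : 0 < p ->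
  {in `]0, 1] &, nonincreasing_fun g} ->
  {in `]0, 1], forall x, 0 <= g x} ->
  (@lebesgue_measure R).-integrable `]0, 1]
    (fun x => (p * x `^ (p - 1) * g x)%:E) ->
  \sum_(1 <= k < n.+1) ((k%:R / n%:R) `^ p - (k.-1%:R / n%:R) `^ p) *
    g (k%:R / n%:R) @[n --> \oo] -->
  \int[lebesgue_measure]_(x in `]0, 1]) (p * x `^ (p - 1) * g x).
Proof.
move=> p0 nig g0 ig.
apply: (cvg_powR_integral_dominated (h_ := right_step g) p0 ig) => //.
- by have /measurable_EFinP := measurable_int _ ig.
- exact: measurable_right_step.
- move=> n x x01; have := x01; rewrite in_itv/= => /andP[x0 x1].
  case: n => [|n]; first by rewrite /right_step big_geq// normr0 g0.
  have [y [xy y1 _ ->]] := @right_stepE _ g n.+1 x isT x0 x1.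
  have y01 : y \in `]0, 1] by rewrite in_itv/= y1 (lt_le_trans x0).
  by rewrite ger0_norm ?g0//; exact: nig.
(* At a continuity point x, right_step g n x is a value of g at distance at
   most 1 / n from x; the single point x = 1 is negligible. *)
- have [N [mN N0 sN]] := ae_continuous_monotone01 (or_intror nig).
  exists (N `|` [set 1]); split.
  + by apply: measurableU.
  + by rewrite measureU0//; exact: lebesgue_measure_set1.
  + move=> x /= /not_implyP[+ ncvg]; rewrite in_itv/= => /andP[x0 x1].
    have [->|xn1] := eqVneq x 1; [by right|left; apply: sN => /= cgx].
    apply: ncvg; apply/cvgrPdist_le => e e0.
    have x01 : x \in `]0, 1[ by rewrite in_itv/= x0 lt_neqAle xn1.
    have /cvgrPdist_le /(_ _ e0) /= [d /= d0 dP] := cgx x01.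
    near=> n.
    have n0 : (0 < n)%N by near: n; exact: nbhs_infty_gt.
    have [y [xy y1 yn ->]] := right_stepE g n0 x0 x1.
    apply: dP => /=; rewrite distrC ger0_norm ?subr_ge0// ltrBlDl.
    apply: (le_lt_trans yn); rewrite ltrD2l.
    rewrite invf_plt ?posrE ?ltr0n//; near: n; exact: nbhs_infty_gtr.
- by move=> n; rewrite integral_right_step.
Unshelve. all: by end_near. Qed.

(** Put [t = k / n].  Then [t^p g(t)] is the integral over [`]0, t]] of
    [p x^(p-1) g(t)], whose integrand is dominated by [p x^(p-1) g(x)] while the
    domain of integration shrinks to nothing. *)
Lemma cvg_powR_sample0 (R : realType) (p : R) (g : R -> R) (k : nat) : 0 < p ->
  {in `]0, 1] &, nonincreasing_fun g} ->
  {in `]0, 1], forall x, 0 <= g x} ->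
  (@lebesgue_measure R).-integrable `]0, 1]
    (fun x => (p * x `^ (p - 1) * g x)%:E) -> (0 < k)%N ->
  (k%:R / n%:R) `^ p * g (k%:R / n%:R) @[n --> \oo] --> 0.
Proof.
move=> p0 nig g0 ig k0.
(* The shift keeps the sample points k / (n + k) in the unit interval. *)
rewrite -(cvg_shiftn k).
pose t (n : nat) : R := k%:R / (n + k)%:R.
have t01 n : t n \in `]0, 1].
  rewrite in_itv/= divr_gt0 ?ltr0n ?addn_gt0 ?k0 ?orbT//=.
  by rewrite ler_pdivrMr ?ltr0n ?addn_gt0 ?k0 ?orbT// mul1r ler_nat leq_addl.
have int0 : \int[lebesgue_measure]_(x in `]0, 1])
    (p * x `^ (p - 1) * cst 0 x) = 0.
  under eq_Rintegral do rewrite mulr0.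
  by rewrite Rintegral_cst// mul0r.
suff : (t n) `^ p * g (t n) @[n --> \oo] --> \int[lebesgue_measure]_(x in `]0, 1])
    (p * x `^ (p - 1) * cst 0 x) by rewrite int0.
apply: (cvg_powR_integral_dominated
  (h_ := fun n x => g (t n) * \1_(`]0, (t n)]) x) p0 ig) => //.
- rewrite (_ : (fun x => _) = cst 0)//.
  by apply/funext => x; rewrite /= mulr0.
- by move=> n; apply: measurable_funM => //; apply: measurable_indic;
    exact: measurable_itv.
- move=> n x x01; rewrite indicE.
  case: (boolP (x \in _)) => xt; last by rewrite mulr0 normr0 g0.
  rewrite mulr1 ger0_norm ?g0//; apply: nig => //.
  by move: xt; rewrite inE/= in_itv/= => /andP[].
- apply: aeW => x; rewrite in_itv/= => /andP[x0 _].
  apply/cvgrPdist_le => e e0; near=> n.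
  rewrite indicE memNset ?mulr0 ?subrr ?normr0 ?(ltW e0)//= in_itv/= x0/=.
  apply/negP; rewrite -ltNge /t ltr_pdivrMr ?ltr0n ?addn_gt0 ?k0 ?orbT//.
  rewrite -ltr_pdivrMl// natrD ltr_wpDr//; near: n; exact: nbhs_infty_gtr.
- move=> n; have := t01 n; rewrite in_itv/= => /andP[/ltW tn0 tn1].
  under eq_integral => x _ do rewrite mulrCA EFinM.
  rewrite integralZl//; last exact: integrable_powR_itv.
  by rewrite integral_powR_itv// -EFinM powR0 ?gt_eqF// subr0 mulrC.
Unshelve. all: by end_near. Qed.

(** * Convergence of the weighted means *)

(** Both sides are the mean of the increments of [k^p] weighted by [g(k/n)],
    after and before summation by parts; hence the total weight in
    [pmean_by_parts] is a right Riemann sum of [g] with respect to [x^p]. *)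
Lemma sum_powR_by_parts (R : realType) (p : R) (g : R -> R) (n : nat) :
  0 < p -> g 1 = 0 ->
  \sum_(1 <= k < n)
    (k%:R / n%:R) `^ p * (g (k%:R / n%:R) - g (k.+1%:R / n%:R)) =
  \sum_(1 <= k < n.+1) ((k%:R / n%:R) `^ p - (k.-1%:R / n%:R) `^ p) *
    g (k%:R / n%:R).
Proof.
move=> p0 g1; rewrite sum_mul_by_parts.
case: n => [|n]; first by rewrite !big_geq// mul0r addr0.
rewrite divff ?pnatr_eq0// g1 mulr0 add0r.
apply: eq_bigr => k _; congr (_ * _).
rewrite big_add1/= telescope_sumr// mul0r powR0 ?subr0// gt_eqF//.
Qed.

(** The hypothesis [g 1 = 0] removes the boundary term of the summation by
    parts.  The weights are nonnegative when [g] is nonincreasing. *)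
Lemma pmean_by_parts (R : realType) (p : R) (b_ : nat -> R[i]) (g : R -> R)
    (n : nat) : g 1 = 0 ->
  pmean b_ g p n = \sum_(1 <= k < n)
    ((k%:R / n%:R) `^ p * (g (k%:R / n%:R) - g (k.+1%:R / n%:R)))%:C *
      (pmean b_ (cst 1) p k : R[i]).
Proof.
move=> g1; rewrite /pmean (@sum_mul_by_parts R[i]).
case: n => [|n]; first by rewrite !big_geq// mul0r addr0 mulr0.
rewrite divff ?pnatr_eq0// g1 mulr0 add0r mulr_sumr big_nat [RHS]big_nat.
apply: eq_bigr => k /andP[k0 _].
under [X in _ = _ * (_ * X)]eq_bigr do rewrite /cst/= mulr1.
have kp : k%:R `^ p != 0 :> R by rewrite gt_eqF// powR_gt0// ltr0n.
have kn : (k%:R / n.+1%:R) `^ p = (n.+1%:R `^ p)^-1 * k%:R `^ p :> R.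
  by rewrite powRM ?invr_ge0// -powR_inv1// -powRrM mulN1r powRN mulrC.
rewrite kn -rmorphB/= !rmorphM/= -!mulrA; congr (_ * _).
by rewrite [RHS]mulrCA [X in _ = _ * X]mulrA -rmorphM/= mulfV// mul1r mulrC.
Qed.

Lemma pmean_cvg_nonincreasing (R : realType) (p : R) (b_ : nat -> R[i])
    (b : R[i]) (g : R -> R) : 0 < p ->
  pmean b_ (cst 1) p n @[n --> \oo] --> (b : R[i]^o) ->
  {in `]0, 1] &, nonincreasing_fun g} -> g 1 = 0 ->
  (@lebesgue_measure R).-integrable `]0, 1]
    (fun x => (p * x `^ (p - 1) * g x)%:E) ->
  pmean b_ g p n @[n --> \oo] -->
    ((\int[lebesgue_measure]_(x in `]0, 1]) (p * x `^ (p - 1) * g x))%:C * b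
      : R[i]^o).
Proof.
move=> p0 cb nig g1 ig.
have g0 : {in `]0, 1], forall x, 0 <= g x}.
  move=> x x01; rewrite -g1; apply: nig; rewrite ?in_itv/= ?ltr01 ?lexx//.
  by move: x01; rewrite in_itv/= => /andP[].
pose w n k := (k%:R / n%:R) `^ p * (g (k%:R / n%:R) - g (k.+1%:R / n%:R)) : R.
have kn01 n k : (0 < k <= n)%N -> (k%:R / n%:R : R) \in `]0, 1].
  move=> /andP[k0 kn]; have n0 : (0 < n)%N := leq_trans k0 kn.
  rewrite in_itv/= divr_gt0 ?ltr0n//= ler_pdivrMr ?ltr0n// mul1r ler_nat//.
have gkn n k : (0 < k < n)%N -> g (k.+1%:R / n%:R) <= g (k%:R / n%:R).
  move=> /andP[k0 kn]; apply: nig; rewrite ?kn01// ?k0 1?ltnW//.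
  by rewrite ler_pM2r ?invr_gt0 ?ltr0n ?(leq_trans _ kn)// ler_nat.
have w0 n k : (0 < k < n)%N -> 0 <= w n k.
  by move=> kn; rewrite mulr_ge0 ?powR_ge0// subr_ge0 gkn.
pose wC n k : R[i] := (w n k)%:C.
have wC_ge0 n k : (0 < k < n)%N -> 0 <= wC n k.
  by move=> kn; rewrite ler0c w0.
have wC_cvg0 k : (0 < k)%N -> wC n k @[n --> \oo] --> (0 : R[i]^o).
  move=> k0; apply: cvg_real_complex.
  apply: (@squeeze_cvgr _ _ _ _ (cst 0) (fun n => (k%:R / n%:R) `^ p * g (k%:R / n%:R))).
  - near=> n; have kn : (k < n)%N by near: n; exact: nbhs_infty_gt.
    rewrite w0 ?k0// ler_wpM2l ?powR_ge0// gerBl.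
    by rewrite g0// kn01.
  - exact: cvg_cst.
  - exact: cvg_powR_sample0.
pose I := \int[lebesgue_measure]_(x in `]0, 1]) (p * x `^ (p - 1) * g x).
have wC_cvg : \sum_(1 <= k < n) wC n k @[n --> \oo] --> (I%:C : R[i]^o).
  have -> : (fun n => \sum_(1 <= k < n) wC n k) =
      (fun n => (\sum_(1 <= k < n.+1) ((k%:R / n%:R) `^ p -
         (k.-1%:R / n%:R) `^ p) * g (k%:R / n%:R))%:C).
    by apply/funext => n; rewrite -sum_powR_by_parts// rmorph_sum.
  by apply: cvg_real_complex; exact: cvg_right_riemann_sum.
have -> : pmean b_ g p =
    (fun n => \sum_(1 <= k < n) wC n k * pmean b_ (cst 1) p k).
  by apply/funext => n; rewrite pmean_by_parts.
exact: (toeplitz_cvg wC_ge0 wC_cvg0 wC_cvg cb).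
Unshelve. all: by end_near. Qed.

Lemma pmean_lincomb (R : realType) (p : R) (b_ : nat -> R[i]) (c d : R)
    (f g : R -> R) (n : nat) :
  pmean b_ (fun x => c * f x + d * g x) p n =
    c%:C * pmean b_ f p n + d%:C * pmean b_ g p n.
Proof.
rewrite /pmean mulrCA [X in _ + X]mulrCA -mulrDr; congr (_ * _).
rewrite !mulr_sumr -big_split/=; apply: eq_bigr => k _.
by rewrite rmorphD !rmorphM mulrDr; congr (_ + _); rewrite mulrCA.
Qed.

Theorem theorem2p2 (R : realType) (p : R) (b_ : nat -> R[i]) (b : R[i])
    (f : R -> R) (absdf : {measure set (measurableTypeR R) -> \bar R}) :
  0 < p ->
  pmean b_ (cst 1) p n @[n --> \oo] --> (b : R[i]^o) ->
  monotone01 f ->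
  (@lebesgue_measure R).-integrable `]0, 1]
    (fun x => (x `^ (p - 1) * f x)%:E) ->
  is_abs_df f absdf ->
  absdf.-integrable `]0, 1] (fun x => (x `^ p)%:E) ->
  pmean b_ f p n @[n --> \oo] -->
    (b * (p * \int[lebesgue_measure]_(x in `]0, 1]) (x `^ (p - 1) * f x))%:C
      : R[i]^o).
Proof.
move=> p0 cb mf intf _ _.
(* The sign c makes g nonincreasing, and subtracting f 1 makes it vanish at 1;
   f is recovered as f 1 + c * g. *)
have [c [cc nig]] : exists c, c * c = 1 /\
    {in `]0, 1] &, nonincreasing_fun (fun x => c * (f x - f 1))}.
  case: mf => [ndf|nif]; [exists (-1)|exists 1]; split; rewrite ?mulrNN ?mulr1//.
    by move=> x y x01 y01 xy; rewrite !mulN1r lerN2 lerD2r ndf.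
  by move=> x y x01 y01 xy; rewrite !mul1r lerD2r nif.
pose g x := c * (f x - f 1).
have g1 : g 1 = 0 by rewrite /g subrr mulr0.
have i1 : (@lebesgue_measure R).-integrable `]0, 1]
    (fun x => (p * x `^ (p - 1))%:E) by exact: integrable_powR01.
have icf : (@lebesgue_measure R).-integrable `]0, 1]
    (fun x => (c * p * (x `^ (p - 1) * f x))%:E).
  by exact: (integrableZl _ (c * p) intf).
have icf1 : (@lebesgue_measure R).-integrable `]0, 1]
    (fun x => (p * x `^ (p - 1) * (c * f 1))%:E).
  by exact: (integrableZr _ (c * f 1) i1).
have gE x : p * x `^ (p - 1) * g x =
    c * p * (x `^ (p - 1) * f x) - p * x `^ (p - 1) * (c * f 1).
  by rewrite /g; ring.
have ig : (@lebesgue_measure R).-integrable `]0, 1]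
    (fun x => (p * x `^ (p - 1) * g x)%:E).
  rewrite (_ : (fun x => _) = (fun x => (c * p * (x `^ (p - 1) * f x))%:E -
      (p * x `^ (p - 1) * (c * f 1))%:E)%E); first exact: integrableB.
  by apply/funext => x; rewrite -EFinB gE.
have int1 : \int[lebesgue_measure]_(x in `]0, 1]) (p * x `^ (p - 1)) = 1.
  by rewrite /Rintegral integral_powR// powR1 powR0 ?gt_eqF// subr0.
pose I := \int[lebesgue_measure]_(x in `]0, 1]) (x `^ (p - 1) * f x).
have intg : \int[lebesgue_measure]_(x in `]0, 1]) (p * x `^ (p - 1) * g x) =
    c * (p * I - f 1).
  rewrite (_ : (fun x => _) = (fun x => c * p * (x `^ (p - 1) * f x) -
      p * x `^ (p - 1) * (c * f 1))); last exact/funext.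
  by rewrite RintegralB// RintegralZl// RintegralZr// int1 -/I; ring.
have := pmean_cvg_nonincreasing p0 cb nig g1 ig.
rewrite intg => cg.
have -> : pmean b_ f p =
    (fun n => (f 1)%:C * pmean b_ (cst 1) p n + c%:C * pmean b_ g p n).
  apply/funext => n; rewrite -pmean_lincomb; congr pmean; apply/funext => x.
  by rewrite /cst/= mulr1 /g mulrA cc mul1r addrC subrK.
have -> : b * (p * I)%:C = (f 1)%:C * b + c%:C * ((c * (p * I - f 1))%:C * b).
  rewrite mulrA -rmorphM/= mulrA cc mul1r -mulrDl -rmorphD/= addrC subrK.
  exact: mulrC.
exact: (@cvg_lincomb R[i] _ _ _ _ (f 1)%:C c%:C cb cg).
Qed.
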